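(* Let $(D,S,F)$ be a POA signature, let $E=E_0\cup E_1$ be a set of $(D\cup S,F)$-equations such that rewriting by $E_1$ modulo $E_0$ is confluent and terminating, let $[\![\_]\!]\colon 0_{E_0}\to N_{E_1/E_0}$ be the normal form homomorphism, let $h\colon 0_E\to N_{E_1/E_0}$ be the isomorphism of $(D\cup S,F)$-algebras, and let $\Gamma$ be a set of $(D,S,F)$-transitions. Write $c_{E_0}$ for the interpretation of a constant $c$ in $0_{E_0}$. Assume: (i) $\Gamma$ is $[\![\_]\!]$-coherent; (ii) for each sentence $\forall X\,H\to(t\Rightarrow t')$ in $\Gamma$, $H$ is a finite conjunction of equations of the form $t_i=c_i$ where $c_i$ is a constant (of $F$) such that $(c_i)_{E_0}$ is a normal form; (iii) for each sort $s$ of an equation $t_i=c_i$ that occurs in a condition of a transition in $\Gamma$: (no junk) each element of $(0_{E_0})_s$ is equal to $c_{E_0}$ for some constant $c\in F_{\to s}$ with $c_{E_0}=[\![c_{E_0}]\!]$; (no confusion) $c_{E_0}\neq c'_{E_0}$ for any two distinct constants $c,c'\in F_{\to s}$ with $c_{E_0}=[\![c_{E_0}]\!]$ and $c'_{E_0}=[\![c'_{E_0}]\!]$. Then $$h\bigl(\stackrel{*}{\longrightarrow}_{\Gamma/E}\bigr)\ \subseteq\ \stackrel{*}{\longrightarrow}_{\Gamma/[\![\_]\!]},$$ i.e. $a\stackrel{*}{\longrightarrow}_{\Gamma/E}a'$ implies $h(a)\stackrel{*}{\longrightarrow}_{\Gamma/[\![\_]\!]}h(a')$.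
   Context: POA signatures. A POA signature is a triple $(D,S,F)$ with $D\cap S=\emptyset$ and $(D\cup S,F)$ a many-sorted algebraic signature (operation symbols $\sigma\in F_{w\to s}$, with arity $w$ and sort $s$; $F_{\to s}$ is the set of constants of sort $s$); elements of $D$ are data sorts, elements of $S$ are system sorts. Terms and variables are those of $(D\cup S,F)$. Atoms are equations $t=t'$ between terms of the same sort, and transitions $t\Rightarrow t'$ between terms of the same system sort. A $(D,S,F)$-transition is a Horn sentence $\forall X\, H\to (t\Rightarrow t')$, where $X$ is a set of variables, $H$ is a finite conjunction of atoms (equations and/or transitions), and the atoms are over $(D\cup S,F\cup X)$. $H_=$ is the set of equations and $H_\to$ the set of transitions in $H$, viewed as sets of pairs of terms. A $(D\cup S,F)$-equation is a (possibly conditional) sentence $\forall X\,H\to(t=t')$ with $H$ a finite conjunction of equational atoms. For a sort-respecting map $\theta\colon X\to B$ into an algebra and a term $t$ over $F\cup X$, $\theta t$ is the value of $t$ in $B$ under $\theta$. Algebraic rewriting. A context $c[z]$ is a term $c$ over $(D\cup S,F\cup\{z\})$, where $z$ is a new variable, such that either $c=z$, or $c=\sigma(c_1,\dots,c_n)$ with $\sigma$ an operation symbol of $F$ and exactly one $k\in\{1,\dots,n\}$ such that $c_k$ is a context, the other $c_i$ ($i\neq k$) being just $(D\cup S,F)$-terms. Let $B$ be a $(D\cup S,F)$-algebra. For a context $c[z]$ of sort $s'$ with $z$ of sort $s$, $B_c\colon B_s\to B_{s'}$ is the identity if $c=z$, and $B_c(b)=B_\sigma(B_{c_1},\dots,B_{c_k}(b),\dots,B_{c_n})$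 if $c=\sigma(c_1,\dots,c_k[z],\dots,c_n)$. Let $\Delta_B=\{(b,b)\mid b\in B\}$ be the diagonal, and for a relation $\Omega\subseteq B\times B$ let $$\Gamma(\Omega)=\{(B_c(\theta t),B_c(\theta t'))\mid c[z]\text{ a context whose sort is a system sort, with } z \text{ of the sort of } t,t',\ (\forall X\,H\to(t\Rightarrow t'))\in\Gamma,\ \theta\colon X\to B,\ \theta H_=\subseteq\Delta_B,\ \theta H_\to\subseteq\Omega\}.$$ Put $\Gamma_{B,0}=\Delta_B$, $\Gamma_{B,k+1}=\Gamma_{B,k}^*\cup\Gamma(\Gamma_{B,k}^* )$, where $R^*$ is the reflexive-transitive closure of $R$. Define $b\longrightarrow_{\Gamma/B}b'$ iff $(b,b')\in\Gamma(\Gamma_{B,k}^* )$ for some $k\in\omega$, and let $\stackrel{*}{\longrightarrow}_{\Gamma/B}$ be the reflexive-transitive closure of $\longrightarrow_{\Gamma/B}$ (on data sorts it is equality). Initial algebras and normal forms. For a set $E$ of equations, $0_E$ is the initial algebra in the class of $(D\cup S,F)$-algebras satisfying $E$; $\longrightarrow_{\Gamma/E}$ and $\stackrel{*}{\longrightarrow}_{\Gamma/E}$ abbreviate $\longrightarrow_{\Gamma/0_E}$ and $\stackrel{*}{\longrightarrow}_{\Gamma/0_E}$. With $E=E_0\cup E_1$, rewriting by $E_1$ modulo $E_0$ is the relation on $0_{E_0}$ obtained by applying the equations of $E_1$, oriented from left to right, inside arbitrary contexts of any sort (for conditional equations, an instance applies when the two sides of each condition rewrite to a common element, defined recursively as usual).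 Standing assumptions: this relation is confluent and terminating, so each $a\in 0_{E_0}$ has a unique normal form $[\![a]\!]$; the set $N_{E_1/E_0}\subseteq 0_{E_0}$ of normal forms is a $(D\cup S,F)$-algebra with $(N_{E_1/E_0})_\sigma(n_1,\dots,n_k)=[\![(0_{E_0})_\sigma(n_1,\dots,n_k)]\!]$; $[\![\_]\!]\colon 0_{E_0}\to N_{E_1/E_0}$ is a homomorphism (with $[\![n]\!]=n$ for $n\in N_{E_1/E_0}$); and, as given by the theory of equational rewriting, there is an isomorphism $h\colon 0_E\to N_{E_1/E_0}$. Computational relation and coherence. On $N_{E_1/E_0}$, $n_1\longrightarrow_{\Gamma/[\![\_]\!]}n_2$ iff there is $u\in 0_{E_0}$ with $n_1\longrightarrow_{\Gamma/E_0}u$ and $[\![u]\!]=n_2$; $\stackrel{*}{\longrightarrow}_{\Gamma/[\![\_]\!]}$ is its reflexive-transitive closure. $\Gamma$ is $[\![\_]\!]$-coherent when, for $a,a'\in 0_{E_0}$, $a\longrightarrow_{\Gamma/E_0}a'$ implies $[\![a]\!]\stackrel{*}{\longrightarrow}_{\Gamma/[\![\_]\!]}[\![a']\!]$. *)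

(* Defs.v *)
From Stdlib Require Export List Relations_1 Relations_2 Relations_3.
Export ListNotations.

Set Implicit Arguments.
Unset Strict Implicit.
Unset Printing Implicit Defensive.

(** * Signatures, algebras, terms *)

Inductive hlist (T : Type) (A : T -> Type) : list T -> Type :=
| hnil : hlist A []
| hcons (s : T) (w : list T) : A s -> hlist A w -> hlist A (s :: w).
Arguments hnil {T A}.

Section HList.
Variables (T : Type) (A B : T -> Type) (f : forall s, A s -> B s).

Fixpoint hmap (w : list T) (l : hlist A w) : hlist B w :=
  match l with
  | hnil => hnil
  | hcons x l' => hcons (f x) (hmap l')
  end.

Fixpoint happ (w1 w2 : list T) (l1 : hlist A w1) (l2 : hlist A w2) :
    hlist A (w1 ++ w2) :=
  match l1 with
  | hnil => l2
  | hcons x l => hcons x (happ l l2)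
  end.
End HList.

(** The disjointness of data sorts and system sorts is built in: the set of
    all sorts is the sum type [dsort + ssort]. *)
Record poa_signature := POASignature {
  dsort : Type;
  ssort : Type;
  op : list (dsort + ssort) -> dsort + ssort -> Type }.

Definition sort (Sg : poa_signature) : Type := (dsort Sg + ssort Sg)%type.

Definition system_sort (Sg : poa_signature) (s : sort Sg) : Prop :=
  match s with inl _ => False | inr _ => True end.

(** Carriers may be empty. *)
Record algebra (Sg : poa_signature) := Algebra {
  carrier :> sort Sg -> Type;
  interp : forall (w : list (sort Sg)) (s : sort Sg),
    op w s -> hlist carrier w -> carrier s }.

Inductive term (Sg : poa_signature) (X : sort Sg -> Type) : sort Sg -> Type :=
| Var (s : sort Sg) : X s -> term X s
| App (w : list (sort Sg)) (s : sort Sg) :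
    op w s -> hlist (term X) w -> term X s.

Definition gterm (Sg : poa_signature) : sort Sg -> Type :=
  term (fun _ : sort Sg => Empty_set).

Definition const (Sg : poa_signature) (X : sort Sg -> Type) (s : sort Sg)
  (c : op [] s) : term X s := App c hnil.

Definition const_val (Sg : poa_signature) (A : algebra Sg) (s : sort Sg)
  (c : op [] s) : A s := interp c hnil.

Fixpoint eval (Sg : poa_signature) (A : algebra Sg) (X : sort Sg -> Type)
    (theta : forall s, X s -> A s) (s : sort Sg) (t : term X s) : A s :=
  match t with
  | Var x => theta _ x
  | App f args => interp f (hmap (eval theta) args)
  end.

Definition geval (Sg : poa_signature) (A : algebra Sg) (s : sort Sg)
  (t : gterm s) : A s :=
  eval (fun _ (x : Empty_set) => match x with end) t.
Arguments geval {Sg} A {s} t.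

(** [context s s'] is the type of contexts of sort [s'] whose hole [z] has
    sort [s]; [CApp f l c r] is [f(l, c[z], r)] with [l] and [r] tuples of
    ground terms. *)
Inductive context (Sg : poa_signature) (s : sort Sg) : sort Sg -> Type :=
| Hole : context s s
| CApp (w1 : list (sort Sg)) (s1 : sort Sg) (w2 : list (sort Sg))
    (s' : sort Sg) :
    op (w1 ++ s1 :: w2) s' ->
    hlist (@gterm Sg) w1 -> context s s1 -> hlist (@gterm Sg) w2 ->
    context s s'.

(** [fill B c b] is the value [B_c(b)]. *)
Fixpoint fill (Sg : poa_signature) (B : algebra Sg) (s s' : sort Sg)
    (c : context s s') (b : B s) : B s' :=
  match c in context _ s' return B s' with
  | Hole _ => b
  | CApp f l c' r =>
      interp f (happ (hmap (@geval Sg B) l)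
                     (hcons (fill c' b) (hmap (@geval Sg B) r)))
  end.

(** * Sentences *)

Record eqn (Sg : poa_signature) (X : sort Sg -> Type) := Eqn {
  eqn_sort : sort Sg;
  eqn_lhs : term X eqn_sort;
  eqn_rhs : term X eqn_sort }.

Record trn (Sg : poa_signature) (X : sort Sg -> Type) := Trn {
  trn_sort : ssort Sg;
  trn_lhs : term X (inr trn_sort);
  trn_rhs : term X (inr trn_sort) }.

Inductive atom (Sg : poa_signature) (X : sort Sg -> Type) :=
| AtomEq (e : eqn X)
| AtomTrn (r : trn X).

Record equation (Sg : poa_signature) := Equation {
  equation_vars : sort Sg -> Type;
  equation_cond : list (eqn equation_vars);
  equation_concl : eqn equation_vars }.

Record transition (Sg : poa_signature) := Transition {
  transition_vars : sort Sg -> Type;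
  transition_cond : list (atom transition_vars);
  transition_concl : trn transition_vars }.

(** * Homomorphisms and initial algebras *)

Definition eqn_holds (Sg : poa_signature) (A : algebra Sg)
  (X : sort Sg -> Type) (theta : forall s, X s -> A s) (e : eqn X) : Prop :=
  eval theta (eqn_lhs e) = eval theta (eqn_rhs e).

Definition satisfies (Sg : poa_signature) (A : algebra Sg)
  (e : equation Sg) : Prop :=
  forall theta : forall s, equation_vars e s -> A s,
    (forall e', In e' (equation_cond e) -> eqn_holds theta e') ->
    eqn_holds theta (equation_concl e).

Definition models (Sg : poa_signature) (E : equation Sg -> Prop)
  (A : algebra Sg) : Prop := forall e, E e -> satisfies A e.

Definition is_hom (Sg : poa_signature) (A B : algebra Sg)
  (h : forall s, A s -> B s) : Prop :=
  forall w s (f : op w s) (args : hlist A w),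
    h s (interp f args) = interp f (hmap h args).

Definition is_iso (Sg : poa_signature) (A B : algebra Sg)
  (h : forall s, A s -> B s) : Prop :=
  is_hom h /\
  exists g : forall s, B s -> A s,
    is_hom g /\ (forall s a, g s (h s a) = a) /\
    (forall s b, h s (g s b) = b).

Definition is_initial (Sg : poa_signature) (E : equation Sg -> Prop)
  (A : algebra Sg) : Prop :=
  models E A /\
  forall B : algebra Sg, models E B ->
    exists h : forall s, A s -> B s, is_hom h /\
      forall h' : forall s, A s -> B s, is_hom h' ->
        forall s a, h' s a = h s a.

Definition equations_union (Sg : poa_signature) (E0 E1 : equation Sg -> Prop) :
  equation Sg -> Prop := fun e => E0 e \/ E1 e.

(** * Algebraic rewriting by transitions *)

Definition srel (Sg : poa_signature) (A : algebra Sg) : Type :=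
  forall s : sort Sg, Relation (A s).

Definition rstar (Sg : poa_signature) (A : algebra Sg) (R : srel A) : srel A :=
  fun s => Rstar (A s) (R s).
Arguments rstar {Sg A} R s _ _.

Definition atom_holds (Sg : poa_signature) (B : algebra Sg) (Omega : srel B)
  (X : sort Sg -> Type) (theta : forall s, X s -> B s) (a : atom X) : Prop :=
  match a with
  | AtomEq e => eqn_holds theta e
  | AtomTrn r => Omega _ (eval theta (trn_lhs r)) (eval theta (trn_rhs r))
  end.

(** One application of a transition of [G], the conditions [t => t'] being
    interpreted in [Omega]. *)
Definition apply_transitions (Sg : poa_signature) (G : transition Sg -> Prop)
  (B : algebra Sg) (Omega : srel B) : srel B :=
  fun s b b' =>
    system_sort s /\
    exists (g : transition Sg)
      (c : context (inr (trn_sort (transition_concl g))) s)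
      (theta : forall s, transition_vars g s -> B s),
      G g /\
      (forall a, In a (transition_cond g) -> atom_holds Omega theta a) /\
      b = fill c (eval theta (trn_lhs (transition_concl g))) /\
      b' = fill c (eval theta (trn_rhs (transition_concl g))).
Arguments apply_transitions {Sg} G {B} Omega s _ _.

Fixpoint transition_level (Sg : poa_signature) (G : transition Sg -> Prop)
    (B : algebra Sg) (k : nat) {struct k} : srel B :=
  match k with
  | 0 => fun s b b' => b = b'
  | S k' =>
      let Omega := rstar (@transition_level Sg G B k') in
      fun s b b' => Omega s b b' \/ apply_transitions G Omega s b b'
  end.
Arguments transition_level {Sg} G B k s _ _.

Definition transition_step (Sg : poa_signature) (G : transition Sg -> Prop)
  (B : algebra Sg) : srel B :=
  fun s b b' => exists k,
    apply_transitions G (rstar (transition_level G B k)) s b b'.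
Arguments transition_step {Sg} G B s _ _.

(** * Rewriting by equations, on the algebra [A] (the initial algebra of the
    equations modulo which one rewrites) *)

(** One left-to-right application of an equation of [E1], the conditions being
    interpreted as joinability for [R] ([coherent] of [Relations_3]). *)
Definition apply_equations (Sg : poa_signature) (E1 : equation Sg -> Prop)
  (A : algebra Sg) (R : srel A) : srel A :=
  fun s a a' =>
    exists (e : equation Sg) (c : context (eqn_sort (equation_concl e)) s)
      (theta : forall s, equation_vars e s -> A s),
      E1 e /\
      (forall e', In e' (equation_cond e) ->
         coherent _ (R (eqn_sort e'))
           (eval theta (eqn_lhs e')) (eval theta (eqn_rhs e'))) /\
      a = fill c (eval theta (eqn_lhs (equation_concl e))) /\
      a' = fill c (eval theta (eqn_rhs (equation_concl e))).
Arguments apply_equations {Sg} E1 {A} R s _ _.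

(** As usual for conditional rewriting, the conditions of a step of level
    [k + 1] are solved with steps of level [k]. *)
Fixpoint equation_level (Sg : poa_signature) (E1 : equation Sg -> Prop)
    (A : algebra Sg) (k : nat) : srel A :=
  match k with
  | 0 => fun s a a' => False
  | S k' => apply_equations E1 (@equation_level Sg E1 A k')
  end.
Arguments equation_level {Sg} E1 A k s _ _.

Definition equation_step (Sg : poa_signature) (E1 : equation Sg -> Prop)
  (A : algebra Sg) : srel A :=
  fun s a a' => exists k, equation_level E1 A k s a a'.
Arguments equation_step {Sg} E1 A s _ _.

Definition sconfluent (Sg : poa_signature) (A : algebra Sg) (R : srel A) :
  Prop := forall s, Confluent (A s) (R s).

Definition sterminating (Sg : poa_signature) (A : algebra Sg) (R : srel A) :
  Prop :=
  forall s, ~ exists a : nat -> A s, forall i, R s (a i) (a (S i)).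

(** * The algebra of normal forms *)

Definition normal (Sg : poa_signature) (E1 : equation Sg -> Prop)
  (A : algebra Sg) (s : sort Sg) (a : A s) : Prop :=
  ~ exists a', equation_step E1 A s a a'.

Definition nform (Sg : poa_signature) (E1 : equation Sg -> Prop)
  (A : algebra Sg) (s : sort Sg) : Type := {a : A s | normal E1 a}.

Definition nf_val (Sg : poa_signature) (E1 : equation Sg -> Prop)
  (A : algebra Sg) (s : sort Sg) (n : nform E1 A s) : A s := proj1_sig n.

(** Under confluence and termination there is, up to pointwise equality,
    exactly one such [nf]. *)
Definition is_normalization (Sg : poa_signature) (E1 : equation Sg -> Prop)
  (A : algebra Sg) (nf : forall s, A s -> nform E1 A s) : Prop :=
  forall s (a : A s), rstar (equation_step E1 A) s a (nf_val (nf s a)).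

Definition nf_algebra (Sg : poa_signature) (E1 : equation Sg -> Prop)
  (A : algebra Sg) (nf : forall s, A s -> nform E1 A s) : algebra Sg :=
  {| carrier := nform E1 A;
     interp := fun w s (f : op w s) (ns : hlist (nform E1 A) w) =>
       nf s (interp f (hmap (@nf_val Sg E1 A) ns)) |}.

Definition nf_transition_step (Sg : poa_signature) (E1 : equation Sg -> Prop)
  (A : algebra Sg) (nf : forall s, A s -> nform E1 A s)
  (G : transition Sg -> Prop) : srel (nf_algebra nf) :=
  fun s n1 n2 => exists u : A s,
    transition_step G A s (nf_val n1) u /\ nf s u = n2.
Arguments nf_transition_step {Sg E1 A} nf G s _ _.

Definition nf_coherent (Sg : poa_signature) (E1 : equation Sg -> Prop)
  (A : algebra Sg) (nf : forall s, A s -> nform E1 A s)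
  (G : transition Sg -> Prop) : Prop :=
  forall s (a a' : A s), transition_step G A s a a' ->
    rstar (nf_transition_step nf G) s (nf s a) (nf s a').

(** * Hypotheses on the conditions of transitions *)

Definition conditions_equate_normal_constants (Sg : poa_signature)
  (E1 : equation Sg -> Prop) (A : algebra Sg) (G : transition Sg -> Prop) :
  Prop :=
  forall g, G g -> forall a, In a (transition_cond g) ->
    exists s (t : term (transition_vars g) s) (c : op [] s),
      a = AtomEq (Eqn t (const _ c)) /\ normal E1 (const_val A c).

Definition condition_sort (Sg : poa_signature) (G : transition Sg -> Prop)
  (s : sort Sg) : Prop :=
  exists g, G g /\ exists e, In (AtomEq e) (transition_cond g) /\ eqn_sort e = s.

Definition no_junk (Sg : poa_signature) (E1 : equation Sg -> Prop)
  (A : algebra Sg) (nf : forall s, A s -> nform E1 A s) (s : sort Sg) : Prop :=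
  forall a : A s, exists c : op [] s,
    a = const_val A c /\ const_val A c = nf_val (nf s (const_val A c)).

Definition no_confusion (Sg : poa_signature) (E1 : equation Sg -> Prop)
  (A : algebra Sg) (nf : forall s, A s -> nform E1 A s) (s : sort Sg) : Prop :=
  forall c c' : op [] s, c <> c' ->
    const_val A c = nf_val (nf s (const_val A c)) ->
    const_val A c' = nf_val (nf s (const_val A c')) ->
    const_val A c <> const_val A c'.

(* Main.v *)
Require Import Defs.
From Stdlib Require Import ProofIrrelevance Relations_2_facts.

Set Implicit Arguments.
Unset Strict Implicit.
Unset Printing Implicit Defensive.

(** Both relations live over the same ground data: [h] presents the initial
    algebra of [E0] and [E1] as the algebra of normal forms, whose elements are
    particular elements of the initial algebra [A0] of [E0].  So a substitution
    [theta] into [AE] lifts to one into [A0] through [h] followed by [nf_val],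
    and the issue is whether a rewrite step on [AE] lifts along with it.

    A condition [t = c] that holds under [theta] only says, a priori, that [t]
    and [c] have the same normal form in [A0] under the lifted substitution.
    Absence of junk turns this into an equality in [A0]: the value of [t] is the
    value of some constant in normal form, so it is a normal form already, as
    [c] is; two normal forms with the same normal form coincide.  This is
    [condition_lifts].  The conditions contain no transitions, so the lifted
    instance is a step of [A0] at every level ([transition_step_lifts]), and
    coherence projects it to a rewrite sequence between the normal forms of its
    two ends.

    Those normal forms are the images under [h] of the ends of the given step
    because [h] and [nf] are both homomorphisms, hence commute with contexts
    and term evaluation.  That [nf] is one ([normalization_is_hom]) rests on
    confluence and on compatibility of equational rewriting with the operations.
    Contexts have only ground terms beside the hole, so the latter
    compatibility uses that every element of an initial algebra is the value of
    a ground term ([initial_reachable]). *)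

(** * Tuples *)

Fixpoint HForall (T : Type) (A : T -> Type) (P : forall s, A s -> Prop)
    (w : list T) (l : hlist A w) : Prop :=
  match l with
  | hnil => True
  | hcons x l' => P _ x /\ HForall P l'
  end.

Lemma hmap_hmap (T : Type) (A B C : T -> Type) (f : forall s, A s -> B s)
  (g : forall s, B s -> C s) (w : list T) (l : hlist A w) :
  hmap g (hmap f l) = hmap (fun s x => g s (f s x)) l.
Proof. induction l; simpl; [reflexivity | now rewrite IHl]. Qed.

Lemma hmap_ext (T : Type) (A B : T -> Type) (f g : forall s, A s -> B s)
  (w : list T) (l : hlist A w) :
  HForall (fun s x => f s x = g s x) l -> hmap f l = hmap g l.
Proof.
induction l; simpl; [reflexivity | intros [H1 H2]].
now rewrite H1, IHl.
Qed.

Lemma hmap_id (T : Type) (A : T -> Type) (w : list T) (l : hlist A w) :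
  hmap (fun _ x => x) l = l.
Proof. induction l; simpl; [reflexivity | now rewrite IHl]. Qed.

Lemma HForall_intro (T : Type) (A : T -> Type) (P : forall s, A s -> Prop)
  (w : list T) (l : hlist A w) : (forall s x, P s x) -> HForall P l.
Proof. intro H; induction l; simpl; auto. Qed.

Lemma HForall_hmap (T : Type) (A B : T -> Type) (f : forall s, A s -> B s)
  (P : forall s, B s -> Prop) (w : list T) (l : hlist A w) :
  HForall (fun s x => P s (f s x)) l -> HForall P (hmap f l).
Proof. induction l; simpl; intuition. Qed.

Lemma HForall_ex_hmap (T : Type) (A B : T -> Type) (f : forall s, A s -> B s)
  (w : list T) (l : hlist B w) :
  HForall (fun s y => exists x, f s x = y) l -> exists l', hmap f l' = l.
Proof.
induction l as [| s w y l IH]; simpl; [now exists hnil | intros [[x <-] H]].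
destruct (IH H) as [l' <-].
now exists (hcons x l').
Qed.

Lemma hmap_happ (T : Type) (A B : T -> Type) (f : forall s, A s -> B s)
  (w1 w2 : list T) (l1 : hlist A w1) (l2 : hlist A w2) :
  hmap f (happ l1 l2) = happ (hmap f l1) (hmap f l2).
Proof. induction l1; simpl; [reflexivity | now rewrite IHl1]. Qed.

(** * Homomorphisms and evaluation *)

(** The generated principle gives no hypothesis on the arguments of [App],
    because they are nested inside [hlist]. *)
Fixpoint term_nested_ind (Sg : poa_signature) (X : sort Sg -> Type)
    (P : forall s, term X s -> Prop)
    (HVar : forall s (x : X s), P s (Var x))
    (HApp : forall w s (f : op w s) (l : hlist (term X) w),
       HForall P l -> P s (App f l))
    (s : sort Sg) (t : term X s) {struct t} : P s t :=
  match t with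
  | Var x => HVar _ x
  | App f l =>
      HApp _ _ f l
        ((fix all w (l : hlist (term X) w) : HForall P l :=
            match l with
            | hnil => I
            | hcons u l' => conj (term_nested_ind HVar HApp u) (all _ l')
            end) _ l)
  end.

Lemma eval_ext (Sg : poa_signature) (A : algebra Sg) (X : sort Sg -> Type)
  (th1 th2 : forall s, X s -> A s) :
  (forall s x, th1 s x = th2 s x) ->
  forall s (t : term X s), eval th1 t = eval th2 t.
Proof.
intros H s t; induction t as [s x | w s f l IH] using term_nested_ind; simpl.
- apply H.
- f_equal; now apply hmap_ext.
Qed.

Lemma hom_eval (Sg : poa_signature) (A B : algebra Sg)
  (h : forall s, A s -> B s) (X : sort Sg -> Type) (th : forall s, X s -> A s) :
  is_hom h ->
  forall s (t : term X s), h s (eval th t) = eval (fun s x => h s (th s x)) t.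
Proof.
intros Hh s t; induction t as [s x | w s f l IH] using term_nested_ind; simpl.
- reflexivity.
- rewrite Hh, hmap_hmap; f_equal; now apply hmap_ext.
Qed.

Lemma hom_geval (Sg : poa_signature) (A B : algebra Sg)
  (h : forall s, A s -> B s) :
  is_hom h -> forall s (t : gterm s), h s (geval A t) = geval B t.
Proof.
intros Hh s t; unfold geval; rewrite hom_eval by assumption.
apply eval_ext; intros s' [].
Qed.

Lemma hom_fill (Sg : poa_signature) (A B : algebra Sg)
  (h : forall s, A s -> B s) :
  is_hom h ->
  forall s s' (c : context s s') (a : A s), h s' (fill c a) = fill c (h s a).
Proof.
intros Hh s s' c a.
assert (Hground : forall w (l : hlist (@gterm Sg) w),
          hmap h (hmap (@geval Sg A) l) = hmap (@geval Sg B) l).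
{ intros w l; rewrite hmap_hmap; apply hmap_ext, HForall_intro.
  now apply hom_geval. }
induction c as [| w1 s1 w2 s' f l c IH r]; simpl; [reflexivity |].
rewrite Hh, hmap_happ; simpl.
now rewrite !Hground, IH.
Qed.

(** * Induction on initial algebras *)

Definition op_closed (Sg : poa_signature) (A : algebra Sg)
  (P : forall s, A s -> Prop) : Prop :=
  forall w s (f : op w s) (args : hlist A w),
    HForall P args -> P s (interp f args).

Lemma HForall_proj1_sig (T : Type) (A : T -> Type) (P : forall s, A s -> Prop)
  (w : list T) (l : hlist (fun s => {a : A s | P s a}) w) :
  HForall P (hmap (fun s x => proj1_sig x) l).
Proof. apply HForall_hmap, HForall_intro; intros s x; exact (proj2_sig x). Qed.

Definition subalgebra (Sg : poa_signature) (A : algebra Sg)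
  (P : forall s, A s -> Prop) (HP : op_closed P) : algebra Sg :=
  {| carrier := fun s => {a : A s | P s a};
     interp := fun w s f args =>
       exist (P s) (interp f (hmap (fun s x => proj1_sig x) args))
         (HP w s f _ (HForall_proj1_sig args)) |}.

(** Conditional equations are inherited because the inclusion is an injective
    homomorphism: it preserves the conditions and reflects the conclusion. *)
Lemma subalgebra_models (Sg : poa_signature) (E : equation Sg -> Prop)
  (A : algebra Sg) (P : forall s, A s -> Prop) (HP : op_closed P) :
  models E A -> models E (subalgebra HP).
Proof.
intros HA e He theta Hcond.
set (incl := fun s (x : subalgebra HP s) => proj1_sig x).
assert (Hincl : is_hom incl) by (intros w s f args; reflexivity).
assert (Hconcl : eqn_holds (fun s x => incl s (theta s x)) (equation_concl e)).
{ apply (HA e He); intros e' He'.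
  generalize (f_equal (incl _) (Hcond e' He')).
  now rewrite !(hom_eval theta Hincl). }
unfold eqn_holds in *.
rewrite <- !(hom_eval theta Hincl) in Hconcl.
revert Hconcl; generalize (eval theta (eqn_lhs (equation_concl e))).
generalize (eval theta (eqn_rhs (equation_concl e))).
intros [y Hy] [x Hx] Hxy; now apply subset_eq_compat.
Qed.

(** The unique endomorphism of [A] factors through the subalgebra on [P], so
    [P] holds everywhere. *)
Lemma initial_ind (Sg : poa_signature) (E : equation Sg -> Prop)
  (A : algebra Sg) (P : forall s, A s -> Prop) :
  is_initial E A -> op_closed P -> forall s a, P s a.
Proof.
intros [HA Hinit] HP s a.
destruct (Hinit (subalgebra HP) (subalgebra_models HA)) as (k & Hk & _).
destruct (Hinit _ HA) as (i & _ & Huniq).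
assert (Hka : proj1_sig (k s a) = a).
{ transitivity (i s a).
  - apply (Huniq (fun s a => proj1_sig (k s a))).
    intros w s' f args; rewrite Hk; simpl; now rewrite hmap_hmap.
  - symmetry; apply (Huniq (fun s a => a)).
    intros w s' f args; now rewrite hmap_id. }
rewrite <- Hka; exact (proj2_sig (k s a)).
Qed.

Lemma initial_reachable (Sg : poa_signature) (E : equation Sg -> Prop)
  (A : algebra Sg) :
  is_initial E A -> forall s (a : A s), exists t : gterm s, geval A t = a.
Proof.
intro HA; apply (initial_ind (P := fun s a => exists t, geval A t = a) HA).
intros w s f args Hargs; destruct (HForall_ex_hmap Hargs) as [ts <-].
now exists (App f ts).
Qed.

(** * Rewriting inside tuples *)

(** One entry is rewritten.  Exhibiting the tuple as [l, x, r] matches the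
    shape of [CApp]; indexing by the whole list of sorts lets the relation be
    iterated along a tuple without any transport along [app] equations. *)
Inductive tuple_step (Sg : poa_signature) (A : algebra Sg) (R : srel A) :
  forall w : list (sort Sg), Relation (hlist A w) :=
| tuple_step_at (w1 : list (sort Sg)) (s : sort Sg) (w2 : list (sort Sg))
    (l : hlist A w1) (x y : A s) (r : hlist A w2) :
    R s x y -> tuple_step R (happ l (hcons x r)) (happ l (hcons y r)).

Lemma tuple_step_cons (Sg : poa_signature) (A : algebra Sg) (R : srel A)
  (s : sort Sg) (z : A s) (w : list (sort Sg)) (l l' : hlist A w) :
  tuple_step R l l' -> tuple_step R (hcons z l) (hcons z l').
Proof.
intros [w1 s1 w2 l1 x y r HR]; exact (tuple_step_at (hcons z l1) r HR).
Qed.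

Lemma Rstar_map (U V : Type) (R : Relation U) (R' : Relation V) (f : U -> V) :
  (forall x y, R x y -> R' (f x) (f y)) ->
  forall x y, Rstar U R x y -> Rstar V R' (f x) (f y).
Proof.
intros Hf x y H; induction H as [x | x y z Hxy _ IH]; [apply Rstar_0 |].
exact (Rstar_n _ _ _ _ _ (Hf _ _ Hxy) IH).
Qed.

Lemma rstar_hmap (Sg : poa_signature) (A : algebra Sg) (R : srel A)
  (f : forall s, A s -> A s) :
  (forall s a, rstar R s a (f s a)) ->
  forall w (l : hlist A w), Rstar _ (@tuple_step Sg A R w) l (hmap f l).
Proof.
intros Hf w l; induction l as [| s w x l IH]; simpl; [apply Rstar_0 |].
apply Rstar_transitive with (hcons (f s x) l).
- apply (Rstar_map (R := R s) (f := fun y => hcons y l)); [| apply Hf].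
  intros y z Hyz; exact (tuple_step_at hnil l Hyz).
- apply (Rstar_map (f := fun l' => hcons (f s x) l')) with (2 := IH).
  intros l1 l2; apply tuple_step_cons.
Qed.

(** A step at an argument is a step under the context that wraps its own
    context in the operation, the other arguments being named by ground
    terms. *)
Lemma equation_step_interp (Sg : poa_signature) (E1 : equation Sg -> Prop)
  (A : algebra Sg) (reach : forall s (a : A s), exists t, geval A t = a)
  (w : list (sort Sg)) (args args' : hlist A w) :
  tuple_step (equation_step E1 A) args args' ->
  forall s (f : op w s), equation_step E1 A s (interp f args) (interp f args').
Proof.
intros [w1 s1 w2 l x y r [[| k] Hk]] s f; [destruct Hk |].
destruct Hk as (e & c & theta & He & Hcond & -> & ->).
assert (Hl := HForall_intro l reach).
assert (Hr := HForall_intro r reach).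
destruct (HForall_ex_hmap Hl) as [lt <-].
destruct (HForall_ex_hmap Hr) as [rt <-].
exists (S k), e, (CApp f lt c rt), theta; auto.
Qed.

(** * Normal forms *)

Section NormalForms.
Variables (Sg : poa_signature) (E0 E1 : equation Sg -> Prop) (A : algebra Sg).
Hypothesis A_initial : is_initial E0 A.
Hypothesis E1_confluent : sconfluent (equation_step E1 A).
Variable nf : forall s, A s -> nform E1 A s.
Hypothesis nfP : is_normalization nf.

Lemma nform_eq (s : sort Sg) (m n : nform E1 A s) :
  nf_val m = nf_val n -> m = n.
Proof. destruct m, n; apply subset_eq_compat. Qed.

Lemma normal_rstar_eq (s : sort Sg) (a b : A s) :
  normal E1 a -> rstar (equation_step E1 A) s a b -> b = a.
Proof.
intros Ha [| y z Hay _]; [reflexivity | destruct Ha; now exists y].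
Qed.

Lemma nf_val_normal (s : sort Sg) (a : A s) :
  normal E1 a -> nf_val (nf a) = a.
Proof. intro Ha; exact (normal_rstar_eq Ha (nfP a)). Qed.

Lemma nf_nf_val (s : sort Sg) (n : nform E1 A s) : nf (nf_val n) = n.
Proof. apply nform_eq, nf_val_normal; exact (proj2_sig n). Qed.

Lemma nf_rstar (s : sort Sg) (a b : A s) :
  rstar (equation_step E1 A) s a b -> nf a = nf b.
Proof.
intro Hab; apply nform_eq.
destruct (E1_confluent (nfP a)
            (Rstar_transitive _ _ _ _ _ Hab (nfP b))) as (z & Hza & Hzb).
transitivity z; [symmetry; exact (normal_rstar_eq (proj2_sig (nf a)) Hza) |].
exact (normal_rstar_eq (proj2_sig (nf b)) Hzb).
Qed.

(** Normalizing the arguments of an operation is a rewrite sequence on the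
    result, and confluence makes normal forms invariant along it. *)
Lemma normalization_is_hom : is_hom (B := nf_algebra nf) nf.
Proof.
intros w s f args; simpl; rewrite hmap_hmap; apply nf_rstar.
apply (Rstar_map (f := fun l => interp f l))
  with (2 := rstar_hmap (f := fun s a => nf_val (nf a)) nfP args).
intros l l' Hl.
exact (equation_step_interp (initial_reachable A_initial) Hl f).
Qed.

(** * Lifting transitions *)

Variables (B : algebra Sg) (h : forall s, B s -> nf_algebra nf s).
Hypothesis h_hom : is_hom h.

Definition lift (s : sort Sg) (b : B s) : A s := nf_val (h b).

Lemma nf_eval_lift (X : sort Sg -> Type) (theta : forall s, X s -> B s)
  (s : sort Sg) (t : term X s) :
  nf (eval (fun s x => lift (theta s x)) t) = h (eval theta t).
Proof.
rewrite (hom_eval (B := nf_algebra nf) _ normalization_is_hom).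
rewrite (hom_eval _ h_hom).
apply (eval_ext (A := nf_algebra nf)); intros s' x; apply nf_nf_val.
Qed.

(** The two sides have equal normal forms, and both are normal: the right one
    by assumption, the left one because the absence of junk makes it the value
    of a constant in normal form. *)
Lemma condition_lifts (X : sort Sg -> Type) (theta : forall s, X s -> B s)
  (s : sort Sg) (t : term X s) (c : op [] s) :
  no_junk nf s -> normal E1 (const_val A c) ->
  eval theta t = eval theta (const X c) ->
  eval (fun s x => lift (theta s x)) t = const_val A c.
Proof.
intros Hjunk Hc Heq.
assert (Hnf := f_equal (@h s) Heq).
rewrite <- !nf_eval_lift in Hnf.
change (eval _ (const X c)) with (const_val A c) in Hnf.
destruct (Hjunk (eval (fun s x => lift (theta s x)) t)) as (c' & Ht & Hc').
rewrite <- Ht, Hnf, (nf_val_normal Hc) in Hc'.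
exact Hc'.
Qed.

Variable G : transition Sg -> Prop.
Hypothesis G_cond : conditions_equate_normal_constants E1 A G.
Hypothesis G_no_junk : forall s, condition_sort G s -> no_junk nf s.

(** The same transition, in the same context, applies under the lifted
    substitution; only its conditions have to be rechecked. *)
Lemma transition_step_lifts (s : sort Sg) (b b' : B s) :
  transition_step G B s b b' ->
  exists a a' : A s,
    transition_step G A s a a' /\ nf a = h b /\ nf a' = h b'.
Proof.
intros (k & Hs & g & c & theta & Hg & Hcond & -> & ->).
set (theta0 := fun s x => lift (theta s x)).
set (r := transition_concl g) in *.
assert (Hfill : forall t : term (transition_vars g) (inr (trn_sort r)),
          nf (fill c (eval theta0 t)) = h (fill c (eval theta t))).
{ intro t; rewrite (hom_fill normalization_is_hom), (hom_fill h_hom).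
  f_equal; apply nf_eval_lift. }
exists (fill c (eval theta0 (trn_lhs r))), (fill c (eval theta0 (trn_rhs r))).
split; [| split; apply Hfill].
(* No condition is a transition, so the level is immaterial. *)
exists 0; split; [exact Hs |].
exists g, c, theta0; repeat split; [exact Hg |].
intros p Hin; destruct (G_cond Hg Hin) as (s' & t & d & -> & Hd).
apply condition_lifts; [| exact Hd | exact (Hcond _ Hin)].
apply G_no_junk; exists g; split; [exact Hg |].
now exists (Eqn t (const _ d)).
Qed.

End NormalForms.

Theorem corollary5p7
  (Sg : poa_signature)
  (E0 E1 : equation Sg -> Prop)
  (A0 : algebra Sg) (A0_initial : is_initial E0 A0)
  (AE : algebra Sg) (AE_initial : is_initial (equations_union E0 E1) AE)
  (E1_confluent : sconfluent (equation_step E1 A0))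
  (E1_terminating : sterminating (equation_step E1 A0))
  (nf : forall s, A0 s -> nform E1 A0 s) (nfP : is_normalization nf)
  (h : forall s, AE s -> nf_algebra nf s) (h_iso : is_iso h)
  (G : transition Sg -> Prop)
  (G_coherent : nf_coherent nf G)
  (G_cond : conditions_equate_normal_constants E1 A0 G)
  (G_no_junk : forall s, condition_sort G s -> no_junk nf s)
  (G_no_confusion : forall s, condition_sort G s -> no_confusion nf s) :
  forall (s : sort Sg) (a a' : AE s),
    rstar (transition_step G AE) s a a' ->
    rstar (nf_transition_step nf G) s (h s a) (h s a').
Proof.
intros s a a' H; induction H as [a | a b a' Hab _ IH]; [apply Rstar_0 |].
apply Rstar_transitive with (h s b); [| exact IH].
destruct (transition_step_lifts A0_initial E1_confluent nfP (proj1 h_iso)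
            G_cond G_no_junk Hab) as (u & u' & Hu & <- & <-).
now apply G_coherent.
Qed.
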